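(* Let $K$ be a compact metric space and let $(Y,\|\cdot\|_Y)$ be a Banach space included in $C(K)$ which separates the points of $K$ and such that $\alpha\|\cdot\|_Y\ge\|\cdot\|_\infty$ on $Y$ for some real number $\alpha\ge 0$. Let $f:K\to\mathbb{R}\cup\{+\infty\}$ be a proper lower semi-continuous function. Then the set $$N(f)=\{\varphi\in Y: f-\varphi \text{ does not have a strong minimum on } K\}$$ is of the first Baire category in $Y$. Moreover, for each separable Banach subspace $Z$ of $(Y,\|\cdot\|_Y)$ which separates the points of $K$, the set $N(f)\cap Z$ can be covered by countably many d.c. hypersurfaces in $Z$. In particular, if $Y$ is separable then $N(f)$ can be covered by countably many d.c. hypersurfaces in $Y$.
   Context: $C(K)$ is the space of real-valued continuous functions on $K$, and $\|\cdot\|_\infty$ the sup-norm. ''Banach space included in $C(K)$'' means a linear subspace of $C(K)$ equipped with a complete norm $\|\cdot\|_Y$ (not necessarily the sup-norm). $f$ is proper if $\{x\in K: f(x)<+\infty\}\neq\emptyset$. A function $g:K\to\mathbb{R}\cup\{+\infty\}$ has a strong minimum at $x$ if $\inf_K g=g(x)$ and $d(x_n,x)\to 0$ whenever $g(x_n)\to g(x)$, where $d$ is the metric of $K$. Let $V,W$ be Banach spaces and $C\subset V$ open convex. A continuous mapping $F:C\to W$ is d.c. (delta-convex) if there is a continuous convex function $g:C\to\mathbb{R}$ such that $w^*\circ F+g$ is convex for every $w^*\in W^*$ with $\|w^*\|\le1$. A subset $A$ of a Banach space $V$ is a d.c. hypersurface in $V$ if there exist a one-dimensional linear subspace $F\subset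 V$, a topological complement $E$ of $F$ in $V$, and a d.c. mapping $\psi:E\to F$ such that $A=\{x+\psi(x):x\in E\}$ (if $\dim V=1$, these are the singletons). *)

(* Defs.v *)
(* MathComp / MathComp-Analysis *)
From HB Require Import structures.
From mathcomp Require Import all_boot all_order all_algebra.
From mathcomp Require Import all_classical all_reals all_analysis.

Set Implicit Arguments.
Unset Strict Implicit.
Unset Printing Implicit Defensive.

Import Order.TTheory GRing.Theory Num.Theory.
Import numFieldNormedType.Exports.

Local Open Scope classical_set_scope.
Local Open Scope ring_scope.

(* A linear subspace [S : submodClosed V] of a normed space [V], as a normed
   space of its own with the norm inherited from [V].  When [V] is a Banach
   space and [S] is closed, this is a Banach space. *)
Section Subspace.
Context {R : realType} {V : normedModType R}.

Inductive subspace_of (S : submodClosed V) : predArgType :=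
  Subspace (x : V) & x \in S.

Definition subspace_val (S : submodClosed V) (z : subspace_of S) : V :=
  let: Subspace x _ := z in x.

Variable S : submodClosed V.

HB.instance Definition _ := [isSub of subspace_of S for @subspace_val S].
HB.instance Definition _ := [Choice of subspace_of S by <:].

Let closedS : GRing.subsemimod_closed (fun x => x \in S).
Proof. exact: (GRing.subsemimodClosedP S). Qed.

HB.instance Definition _ :=
  GRing.SubChoice_isSubLmodule.Build R V _ (subspace_of S) closedS.

Let norm (z : subspace_of S) : R := `|val z|.

Let norm_triangle x y : norm (x + y) <= norm x + norm y.
Proof. by rewrite /norm raddfD; exact: ler_normD. Qed.

Let normZ (l : R) x : norm (l *: x) = `|l| * norm x.
Proof. by rewrite /norm linearZ/= normrZ. Qed.

Let norm_eq0 x : norm x = 0 -> x = 0.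
Proof. by move=> /normr0_eq0 x0; apply: val_inj; rewrite x0 raddf0. Qed.

HB.instance Definition _ := Lmodule_isNormed.Build R (subspace_of S)
  norm_triangle normZ norm_eq0.

End Subspace.

Section Category.
Context {T : topologicalType}.

Definition nowhere_dense (A : set T) := interior (closure A) = set0.

Definition first_category (A : set T) := exists B : nat -> set T,
  (forall n, nowhere_dense (B n)) /\ A = \bigcup_n B n.

End Category.

Definition separable (T : topologicalType) :=
  exists D : set T, countable D /\ dense D.

Section FunctionsOnK.
Context {R : realType} {K : metricType R}.

Definition sup_norm (g : K -> R) : R := sup (range (fun x => `|g x|)).

Definition separates_points (S : set (K -> R)) :=
  forall x y, x <> y -> exists g, S g /\ g x <> g y.

Definition strong_minimum_at (g : K -> \bar R) (x : K) :=
  ereal_inf (range g) = g x /\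
  forall u : nat -> K, g (u n) @[n --> \oo] --> g x ->
    mdist (u n) x @[n --> \oo] --> (0 : R).

Definition has_strong_minimum (g : K -> \bar R) :=
  exists x, strong_minimum_at g x.

End FunctionsOnK.

(* [F] and [g] are total functions of which only the values on [C] matter.
   The dual unit ball of [W] consists of the continuous linear functionals [w]
   such that the supremum of [`|w y|] over the unit ball of [W] is at most 1. *)
Definition dc_mapping {R : realType} {V W : normedModType R}
    (C : set V) (F : V -> W) :=
  [/\ open C, convex_set C, {within C, continuous F} &
   exists g : V -> R,
     [/\ {within C, continuous g}, convex_function C g &
      forall w : {linear W -> R^o}, continuous w ->
        (forall y, `|y| <= 1 -> `|w y| <= 1) ->
        convex_function C (fun x => w (F x) + g x)]].

Section Hypersurface.
Context {R : realType} {V : normedModType R}.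

Definition one_dimensional (F : submodClosed V) :=
  exists2 u : V, u != 0 & forall v, v \in F <-> exists t : R, v = t *: u.

(* In a Banach space: both summands are closed and the sum is direct. *)
Definition topological_complement (E F : submodClosed V) :=
  [/\ closed [set` E], closed [set` F],
      forall v, v \in E -> v \in F -> v = 0 &
      forall v : V, exists x y, [/\ x \in E, y \in F & v = x + y]].

Definition dc_hypersurface (A : set V) := exists F E : submodClosed V,
  [/\ one_dimensional F, topological_complement E F &
   exists psi : subspace_of E -> subspace_of F,
     dc_mapping setT psi /\
     A = range (fun x : subspace_of E => val x + val (psi x))].

(* A countable family may be empty; this matters for [V = 0], in which there
   is no d.c. hypersurface at all. *)
Definition countably_dc_covered (A : set V) := exists H : set (set V),
  [/\ countable H, forall B, H B -> dc_hypersurface B &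
      A `<=` \bigcup_(B in H) B].

End Hypersurface.

(* An abstract Banach space [Y] stands for a linear subspace of C(K) with a norm
   of its own: [iota] is the inclusion, sending [phi] to a function on [K]. *)
Definition no_strong_minimum {R : realType} {K : metricType R}
    {Y : normedModType R} (iota : Y -> K -> R) (f : K -> \bar R) : set Y :=
  [set phi | ~ has_strong_minimum (fun x => f x - (iota phi x)%:E)%E].

(* Main.v *)
Require Import Defs.
From HB Require Import structures.
From mathcomp Require Import all_boot all_order all_algebra.
From mathcomp Require Import all_classical all_reals all_analysis.
From mathcomp Require Import lra ring.

(** Since [K] is compact and [f - phi] is lower semicontinuous, minimizers exist,
    and a unique minimizer is automatically a strong one: the strict sublevel sets
    generate a filter whose only cluster point it is ([unique_minimizer_strong]).
    So [phi] belongs to N(f) only if [f - phi] has two distinct minimizers [x] and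
    [y].  Take [g] with [iota g x < iota g y] in a countable family that still
    separates points, and rationals [p < q] strictly between these two values.
    The suprema of [phi - f] over the places where [iota g >= q] and where
    [iota g <= p] then coincide, both being the supremum over the whole domain of
    [f].  Hence N(f) is covered by countably many tie sets [u = v], where [u] and
    [v] are the two partial suprema, as functions of [phi]
    ([no_strong_minimum_tie]).

    These functions are convex and Lipschitz, and along the direction [g] the
    slopes of [u] are at least [q] while those of [v] are at most [p].  Therefore
    [u - v] grows at rate at least [q - p] along [g], and each line parallel to
    [g] meets the tie set in exactly one point.  In particular the tie set, which
    is closed, has empty interior; this gives first category, even when [Y] is not
    separable, because by compactness of [K] countably many elements of [Y]
    already separate the points ([countable_separating]).

    For the d.c. statement, write the crossing point on the line through [x] as
    [x + tau x *: g].  With k = (p + q) / 2, the functions [u (x + t *: g) - k t]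
    and [v (x + t *: g) - k t] of [t] have slopes at least (q - p) / 2 and at most
    - (q - p) / 2, so their maximum is smallest at the crossing, where its value
    is [crossing_level x].  Being the partial minimum of a jointly convex
    function, the level is convex; and as that function has a kink of opening
    (q - p) / 2 at its minimum, the defect of convexity of the level dominates
    (q - p) / 2 times the deviation of [tau] from affinity
    ([crossing_level_gap]).  A multiple of the level is thus a control function
    for [tau] ([crossing_control_convex]), and the tie set is the graph of a d.c.
    mapping over a hyperplane.  The complement of the line spanned by [g] needs no
    extension theorem: it is the kernel of the evaluation at a point of [K] where
    [iota g] does not vanish.

    The argument is carried out for a normed space [V] with a bounded linear map
    to the functions on [K], and then applied to [Y] and to its subspaces. *)

Set Implicit Arguments.
Unset Strict Implicit.
Unset Printing Implicit Defensive.

Import Order.TTheory GRing.Theory Num.Theory.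
Import numFieldNormedType.Exports.

Local Open Scope classical_set_scope.
Local Open Scope ring_scope.

(** * Minimizers and strong minima on a compact space *)

Lemma real_between (R : realType) (x y : \bar R) : (x < y)%E ->
  exists a : R, (x < a%:E)%E /\ (a%:E < y)%E.
Proof.
case: x y => [r| |] [s| |] //=.
- by rewrite lte_fin => rs; exists ((r + s) / 2); rewrite !lte_fin; split; lra.
- by move=> _; exists (r + 1); rewrite lte_fin ltry; split=> //; lra.
- by move=> _; exists (s - 1); rewrite lte_fin ltNyr; split=> //; lra.
- by move=> _; exists 0; rewrite ltNyr ltry.
Qed.

Definition minimizing_filter (R : realType) (K : Type) (g : K -> \bar R) :
    set_system K :=
  filter_from [set a : R | (ereal_inf (range g) < a%:E)%E]
    (fun a => [set y | (g y < a%:E)%E]).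

Lemma minimizing_filter_proper (R : realType) (K : Type) (g : K -> \bar R) :
  (exists x, (g x < +oo)%E) -> ProperFilter (minimizing_filter g).
Proof.
move=> [x gx]; apply: filter_from_proper; last first.
  by move=> a /ereal_inf_lt[_ [y _ <-] gya]; exists y.
apply: filter_from_filter.
  have /real_between[a [ga _]] : (ereal_inf (range g) < +oo)%E.
    by apply: le_lt_trans gx; apply: ereal_inf_lbound; exists x.
  by exists a.
move=> a b /= ga gb; exists (Num.min a b); first by rewrite /= EFin_min lt_min ga.
by move=> y /=; rewrite EFin_min lt_min => /andP[].
Qed.

(** If [g x] exceeded the infimum, a real number [a] strictly between them would
    give a neighbourhood of [x] on which [g > a], disjoint from the member
    [g < a] of the filter. *)
Lemma cluster_minimizing_filter (R : realType) (K : topologicalType)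
    (g : K -> \bar R) (x : K) :
  lower_semicontinuous g -> cluster (minimizing_filter g) x ->
  ereal_inf (range g) = g x.
Proof.
move=> glsc cx; apply/eqP; rewrite eq_le.
rewrite ereal_inf_lbound/=; last by exists x.
rewrite leNgt; apply/negP => /real_between[a [ga agx]].
have [V Vx Va] := glsc x a agx.
have [|y [/= gya Vy]] := cx [set y | (g y < a%:E)%E] V _ Vx; first by exists a.
by have := lt_trans (Va y Vy) gya; rewrite ltxx.
Qed.

Lemma compact_minimizer (R : realType) (K : topologicalType) (g : K -> \bar R) :
  compact [set: K] -> lower_semicontinuous g -> (exists x, (g x < +oo)%E) ->
  exists x, ereal_inf (range g) = g x.
Proof.
move=> cK glsc /minimizing_filter_proper PF.
have [|x [_ cx]] := cK _ PF; first exact: filterT.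
by exists x; exact: cluster_minimizing_filter.
Qed.

(** On a compact Hausdorff space a filter with a single cluster point converges
    to it.  The minimizing filter therefore converges to [x], and the image of
    [\oo] under any minimizing sequence is finer than that filter. *)
Lemma unique_minimizer_strong (R : realType) (K : metricType R)
    (g : K -> \bar R) (x : K) :
  compact [set: K] -> lower_semicontinuous g -> (exists x, (g x < +oo)%E) ->
  ereal_inf (range g) = g x ->
  (forall y, ereal_inf (range g) = g y -> y = x) -> strong_minimum_at g x.
Proof.
move=> cK glsc /minimizing_filter_proper PF gx ux; split=> // u ugx.
have Fx : minimizing_filter g --> x.
  apply: (compact_cluster_set1 (@metric_hausdorff R K) cK) => //; try exact: filterT.
  apply/seteqP; split=> [y /(cluster_minimizing_filter glsc)|y ->].
    by move/ux.
  have [|z [_ cz]] := cK _ PF; first exact: filterT.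
  by rewrite -(ux z)//; exact: cluster_minimizing_filter.
have ux' : u n @[n --> \oo] --> x.
  apply: cvg_trans Fx => A [a /= ga aA]; rewrite nbhs_simpl/=.
  have agx : nbhs (g x) [set z | (z < a%:E)%E].
    have := @open_ereal_lt_ereal R a%:E; rewrite openE; apply.
    by rewrite /= -gx.
  have : \forall n \near \oo, (g (u n) < a%:E)%E := ugx _ agx.
  by apply: filterS => n; exact: aA.
apply/cvgrPdist_lt => e e0.
have [+ _] := metricType_numDomainType.cvgrPdist_lt (F := \oo) u x.
move=> /(_ ux' e e0); apply: filterS => n.
by rewrite sub0r normrN ger0_norm ?mdist_ge0// metric_sym.
Qed.

Lemma lsc_sub_continuous (R : realType) (K : topologicalType)
    (f : K -> \bar R) (h : K -> R) :
  lower_semicontinuous f -> continuous h ->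
  lower_semicontinuous (fun x => f x - (h x)%:E)%E.
Proof.
move=> flsc ch x a; rewrite lteBrDr// -EFinD => /real_between[b [ab bf]].
have [V Vx Vb] := flsc x b bf.
exists (V `&` [set y | h y < b - a]).
  have hx : h x < b - a by move: ab; rewrite lte_fin; lra.
  apply: filterI => //; exact: (ch x _ (lt_nbhsl hx)).
move=> y [/Vb bfy /= hy]; change (a%:E < f y - (h y)%:E)%E; rewrite lteBrDr// -EFinD.
by apply: lt_trans bfy; rewrite lte_fin; lra.
Qed.

(** * Lipschitz, convex and linear preliminaries *)

Lemma norm_lipschitz_continuous (R : realType) (V W : normedModType R) (L : R)
    (F : V -> W) :
  (forall x y, `|F x - F y| <= L * `|x - y|) -> continuous F.
Proof.
move=> FL x; apply/cvgrPdist_lt => e e0.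
have d0 : 0 < e / (`|L| + 1) by rewrite divr_gt0// ltr_wpDl.
near=> y; apply: (le_lt_trans (FL x y)).
have h : `|x - y| < e / (`|L| + 1) by near: y; exact: cvgr_dist_lt.
rewrite ltr_pdivlMr ?ltr_wpDl// in h.
apply: le_lt_trans h; rewrite mulrC ler_wpM2l//.
by rewrite (le_trans (ler_norm _))// lerDl.
Unshelve. all: by end_near. Qed.

Lemma convex_functionTP (R : realType) (V : lmodType R) (h : V -> R) :
  convex_function setT h <-> forall (t : {i01 R}) x y,
    h (t%:num *: x + (1 - t%:num) *: y) <= t%:num * h x + (1 - t%:num) * h y.
Proof.
split=> [hc t x y|hc t x y _ _]; last exact: hc.
exact: (hc t x y (in_setT _) (in_setT _)).
Qed.

Lemma submodClosed_of_pred (R : realType) (V : lmodType R) (P : V -> Prop) :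
  P 0 -> (forall a x y, P x -> P y -> P (a *: x + y)) ->
  exists S : submodClosed V, forall x, x \in S <-> P x.
Proof.
move=> P0 PD; pose S : {pred V} := fun x => `[< P x >].
have cl : GRing.subsemimod_closed S.
  apply: GRing.submod_closed_semi; split; first by apply/asboolP.
  by move=> a x y /asboolP Px /asboolP Py; apply/asboolP; exact: PD.
pose T : submodClosed V := HB.pack S (GRing.isSubmodClosed.Build R V S cl).
by exists T => x; split=> [/asboolP|?]//; apply/asboolP.
Qed.

Lemma closed_zero_set (R : realType) (T : topologicalType) (W : normedModType R)
    (h : T -> W) : continuous h -> closed [set x | h x = 0].
Proof.
move=> /continuous_closedP /(_ [set 0]); apply.
apply: accessible_closed_set1; exact/hausdorff_accessible/norm_hausdorff.
Qed.

(** * The crossing of two convex functions along a direction *)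

Section Crossing.
Context (R : realType) (V : normedModType R) (g : V) (p q L : R) (u v : V -> R).
Hypothesis pq : p < q.
Hypothesis uL : forall x y, `|u x - u y| <= L * `|x - y|.
Hypothesis vL : forall x y, `|v x - v y| <= L * `|x - y|.
Hypothesis ug : forall x (t : R), 0 <= t -> u x + t * q <= u (x + t *: g).
Hypothesis vg : forall x (t : R), 0 <= t -> v (x + t *: g) <= v x + t * p.

Lemma crossing_gap x t : 0 <= t ->
  u x - v x + t * (q - p) <= u (x + t *: g) - v (x + t *: g).
Proof. by move=> t0; have := ug x t0; have := vg x t0; nra. Qed.

Let shift x s t : x + s *: g + (t - s) *: g = x + t *: g.
Proof. by rewrite -addrA -scalerDl (addrC s) subrK. Qed.

(** The linear growth of [u - v] along [g], read backwards: the gap at a point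
    bounds its distance to the crossing on the same line. *)
Lemma crossing_dist x s t : u (x + s *: g) = v (x + s *: g) ->
  (q - p) * `|t - s| <= `|u (x + t *: g) - v (x + t *: g)|.
Proof.
move=> ts; have [st|/ltW st] := leP s t.
- have := @crossing_gap (x + s *: g) (t - s); rewrite subr_ge0 => /(_ st).
  rewrite shift ts subrr add0r mulrC => h.
  by rewrite (ger0_norm (_ : 0 <= t - s)) ?subr_ge0// (le_trans h)// ler_norm.
- have := @crossing_gap (x + t *: g) (s - t); rewrite subr_ge0 => /(_ st).
  rewrite shift ts subrr => h.
  rewrite distrC (ger0_norm (_ : 0 <= s - t)) ?subr_ge0//.
  by rewrite -normrN (le_trans _ (ler_norm _))//; lra.
Qed.

Lemma crossing_unique x s t : u (x + s *: g) = v (x + s *: g) ->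
  u (x + t *: g) = v (x + t *: g) -> s = t.
Proof.
move=> ts tt; have := crossing_dist t ts; rewrite tt subrr normr0.
by rewrite pmulr_rle0 ?subr_gt0// normr_le0 subr_eq0 => /eqP->.
Qed.

(** [u - v] grows at least at rate [q - p] in [t], so it changes sign between
    [t = - a] and [t = a] for [a = `|u x - v x| / (q - p)]. *)
Lemma crossing_exists x : exists t, u (x + t *: g) = v (x + t *: g).
Proof.
pose D t := u (x + t *: g) - v (x + t *: g).
have qp0 : 0 < q - p by rewrite subr_gt0.
have Dc : continuous D.
  have lc : continuous (fun t : R => x + t *: g).
    by move=> t; apply: cvgD; [exact: cvg_cst|apply: cvgZr_tmp; exact: cvg_id].
  move=> t; apply: cvgB.
    by apply: continuous_comp; [exact: lc|exact: norm_lipschitz_continuous uL _].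
  by apply: continuous_comp; [exact: lc|exact: norm_lipschitz_continuous vL _].
pose a := `|u x - v x| / (q - p).
have a0 : 0 <= a by rewrite divr_ge0// ltW.
have aE : a * (q - p) = `|u x - v x| by rewrite divfK ?gt_eqF.
have Da : 0 <= D a.
  have := crossing_gap x a0; rewrite aE; have := ler_norm (- (u x - v x)).
  by rewrite normrN /D; lra.
have DNa : D (- a) <= 0.
  have := crossing_gap (x + (- a) *: g) a0; rewrite aE.
  have -> : x + (- a) *: g + a *: g = x.
    by rewrite -addrA -scalerDl addNr scale0r addr0.
  have := ler_norm (u x - v x); rewrite /D; lra.
have [||t _ /eqP] := @IVT R D (- a) a 0 _ (continuous_subspaceT Dc).
- by lra.
- by rewrite ge_min DNa/= le_max Da orbT.
by rewrite subr_eq0 => /eqP; exists t.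
Qed.

Variable tau : V -> R.
Hypothesis tauP : forall x, u (x + tau x *: g) = v (x + tau x *: g).

(** The crossing height [tau x] above [x] leaves at [y] a gap of at most twice
    the Lipschitz bound, and [crossing_dist] turns it into a distance. *)
Lemma crossing_lipschitz x y : `|tau x - tau y| <= (2 * L / (q - p)) * `|x - y|.
Proof.
have qp0 : 0 < q - p by rewrite subr_gt0.
rewrite mulrAC ler_pdivlMr// mulrC (le_trans (crossing_dist (tau x) (tauP y)))//.
have e : y + tau x *: g - (x + tau x *: g) = y - x.
  by rewrite opprD addrACA subrr addr0.
have := uL (y + tau x *: g) (x + tau x *: g).
have := vL (y + tau x *: g) (x + tau x *: g).
rewrite e distrC tauP => h1 h2.
rewrite [X in _ <= X](_ : _ = L * `|y - x| + L * `|y - x|); last first.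
  by rewrite (distrC x); ring.
apply: le_trans (lerD h2 h1).
exact: ler_distD.
Qed.

(** The minimum over [t] of the larger of [u (x + t *: g) - k * t] and
    [v (x + t *: g) - k * t], for the slope k = (p + q) / 2 halfway between the
    slopes of [v] and those of [u]; it is attained where they are equal. *)
Definition crossing_level x := u (x + tau x *: g) - (p + q) / 2 * tau x.

Hypothesis u_cvx : convex_function setT u.
Hypothesis v_cvx : convex_function setT v.

(** The convex combination of the crossing points over [x] and [y] lies on the
    line through [z] at height [s], the interpolated value of [tau].  There [u]
    and [v] are both at most, by convexity, the interpolation of their common
    values at the crossings over [x] and [y].  If [s] is above the crossing over
    [z], the slope of [u] makes [u] exceed its value at that crossing by at least
    [(s - tau z) * q]; if it is below, the slope of [v] makes [v] exceed it by at
    least [(s - tau z) * p].  Subtraction of the mean slope turns both bounds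
    into [(q - p) / 2 * `|s - tau z|]. *)
Lemma crossing_level_gap (t : {i01 R}) x y :
  let a := t%:num in let z := a *: x + (1 - a) *: y in
  (q - p) / 2 * `|a * tau x + (1 - a) * tau y - tau z| <=
  a * crossing_level x + (1 - a) * crossing_level y - crossing_level z.
Proof.
rewrite /=; set a := t%:num; set z := a *: x + _; set s := a * tau x + (1 - a) * tau y.
have zE : z + s *: g = a *: (x + tau x *: g) + (1 - a) *: (y + tau y *: g).
  by rewrite /z /s (scalerDl g) !scalerDr -!scalerA addrACA.
have := (convex_functionTP u).1 u_cvx t (x + tau x *: g) (y + tau y *: g).
have := (convex_functionTP v).1 v_cvx t (x + tau x *: g) (y + tau y *: g).
rewrite -/a -zE -!tauP => hv hu.
rewrite [X in _ <= X](_ : _ = a * u (x + tau x *: g) +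
  (1 - a) * u (y + tau y *: g) - u (z + tau z *: g) - (p + q) / 2 * (s - tau z));
  last by rewrite /crossing_level /s; ring.
have [zs|/ltW sz] := leP (tau z) s.
- have := @ug (z + tau z *: g) (s - tau z); rewrite subr_ge0 => /(_ zs).
  by rewrite shift ger0_norm ?subr_ge0// => h; lra.
- have := @vg (z + s *: g) (tau z - s); rewrite subr_ge0 => /(_ sz).
  by rewrite shift -tauP ler0_norm ?subr_le0// => h; lra.
Qed.

(** [s] will be the value at [g] of a functional on the line spanned by [g], and
    [k] the norm of [g], so that one control function serves all functionals of
    norm at most 1. *)
Lemma crossing_control_convex s k : `|s| <= k ->
  convex_function setT (fun x => s * tau x + 2 / (q - p) * k * crossing_level x).
Proof.
move=> sk; apply/convex_functionTP => t x y; have := crossing_level_gap t x y => /=.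
set a := t%:num; set z := a *: x + _.
set d := a * tau x + _ - _; set c := _ - crossing_level z => dc.
have qp0 : 0 < q - p by rewrite subr_gt0.
have {}dc : k * `|d| <= 2 / (q - p) * k * c.
  rewrite [2 / _ * k]mulrC -mulrA ler_wpM2l ?(le_trans _ sk)//.
  by rewrite -[2 / _]invf_div ler_pdivlMl ?divr_gt0.
have sd : - (k * `|d|) <= s * d.
  by rewrite lerNl (le_trans (ler_norm _))// normrN normrM ler_wpM2r//.
rewrite -subr_ge0 [X in 0 <= X](_ : _ = s * d + 2 / (q - p) * k * c); last first.
  by rewrite /d /c; ring.
by lra.
Qed.
End Crossing.

(** * The crossing set as a d.c. hypersurface *)

Section CrossingSet.
Context (R : realType) (V : normedModType R) (g : V) (p q L : R) (u v : V -> R).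
Hypothesis pq : p < q.
Hypothesis uL : forall x y, `|u x - u y| <= L * `|x - y|.
Hypothesis vL : forall x y, `|v x - v y| <= L * `|x - y|.
Hypothesis ug : forall x (t : R), 0 <= t -> u x + t * q <= u (x + t *: g).
Hypothesis vg : forall x (t : R), 0 <= t -> v (x + t *: g) <= v x + t * p.
Hypothesis u_cvx : convex_function setT u.
Hypothesis v_cvx : convex_function setT v.
Context (l : V -> R).
Hypothesis l_lin : forall a x y, l (a *: x + y) = a * l x + l y.
Hypothesis l_cont : continuous l.
Hypothesis lg : l g = 1.

(** Every [x] decomposes as [(x - l x *: g) + l x *: g], so the kernel of [l] is
    a closed complement of the line spanned by [g], and the crossing set is the
    graph over it of [e |-> tau e *: g]. *)
Lemma crossing_set_dc_hypersurface : dc_hypersurface [set x | u x = v x].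
Proof.
have l0 : l 0 = 0 by have := l_lin 1 0 0; rewrite scaler0 addr0; lra.
have lZ a x : l (a *: x) = a * l x by rewrite -[a *: x]addr0 l_lin l0 addr0.
have lB x a : l (x - a *: g) = l x - a.
  by rewrite addrC -scaleNr l_lin lg; lra.
have g0 : g != 0 by apply/eqP => gE; have := lg; rewrite gE l0; lra.
have [F FP] : exists S : submodClosed V, forall x, x \in S <-> exists t : R, x = t *: g.
  apply: submodClosed_of_pred; first by exists 0; rewrite scale0r.
  by move=> a _ _ [s ->] [t ->]; exists (a * s + t); rewrite scalerDl scalerA.
have [E EP] : exists S : submodClosed V, forall x, x \in S <-> l x = 0.
  by apply: submodClosed_of_pred => // a x y lx ly; rewrite l_lin lx ly mulr0 addr0.
have [tau tauP] := choice (crossing_exists pq uL vL ug vg).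
exists F, E; split; first by exists g => // x; exact: FP.
  split.
  - have -> : [set` E] = [set x | l x = 0] by apply/seteqP; split=> x /= /EP.
    exact: (@closed_zero_set _ _ R^o).
  - have -> : [set` F] = [set x | x - l x *: g = 0].
      apply/seteqP; split=> x /=.
        by move=> /FP[t ->]; rewrite lZ lg mulr1 subrr.
      by move=> /eqP; rewrite subr_eq0 => /eqP xE; apply/FP; exists (l x).
    apply: closed_zero_set => x; apply: cvgB; first exact: cvg_id.
    by apply: cvgZr_tmp; exact: l_cont.
  - by move=> x /EP lx /FP[t xE]; move: lx; rewrite xE lZ lg mulr1 => ->; rewrite scale0r.
  - move=> x; exists (x - l x *: g), (l x *: g); split; last by rewrite subrK.
      by apply/EP; rewrite lB subrr.
    by apply/FP; exists (l x).
have gF t : t *: g \in F by apply/FP; exists t.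
pose psi (e : subspace_of E) := Subspace (gF (tau (val e))).
exists psi; split; last first.
  apply/seteqP; split=> x /=.
    move=> xt; have xE : x - l x *: g \in E by apply/EP; rewrite lB subrr.
    exists (Subspace xE) => //=; rewrite (_ : tau _ = l x) ?subrK//.
    apply: (@crossing_unique _ _ g p q u v pq ug vg (x - l x *: g)) => //.
    by rewrite subrK.
  by move=> [e _ <-] /=; exact: tauP.
have valD (S : submodClosed V) (x y : subspace_of S) : val (x - y) = val x - val y.
  exact: raddfB.
have valc (S : submodClosed V) : continuous (val : subspace_of S -> V).
  apply: (@norm_lipschitz_continuous _ _ _ 1) => x y.
  by rewrite mul1r -valD.
have tau_cont : continuous tau.
  exact: (norm_lipschitz_continuous (crossing_lipschitz pq uL vL ug vg tauP)).
have level_cont : continuous (crossing_level g p q u tau).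
  have u_cont := norm_lipschitz_continuous uL.
  move=> x; apply: cvgB.
    apply: (continuous_comp (f := fun x => x + tau x *: g)); last exact: u_cont.
    by apply: cvgD; [exact: cvg_id|apply: cvgZr_tmp; exact: tau_cont].
  by apply: cvgM; [exact: cvg_cst|exact: tau_cont].
split; [exact: openT|by move=> *; exact: in_setT| |].
  apply: continuous_subspaceT.
  apply: (@norm_lipschitz_continuous _ _ _ (2 * L / (q - p) * `|g|)) => x y.
  rewrite [X in X <= _](_ : _ = `|tau (val x) - tau (val y)| * `|g|).
    rewrite mulrAC ler_wpM2r//.
    have := crossing_lipschitz pq uL vL ug vg tauP (val x) (val y).
    by rewrite -valD.
  by rewrite -normrZ scalerBl.
exists (fun e => 2 / (q - p) * `|g| * crossing_level g p q u tau (val e)).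
have valE (t : {i01 R}) (x y : subspace_of E) :
  val (t%:num *: x + (1 - t%:num) *: y) = t%:num *: val x + (1 - t%:num) *: val y.
  by rewrite raddfD; congr (_ + _); exact: linearZ.
split.
- apply: continuous_subspaceT => e; set k := 2 / _ * _.
  have kc : continuous (fun x => k * crossing_level g p q u tau x).
    by move=> x; apply: cvgM; [exact: cvg_cst|exact: level_cont].
  exact: (continuous_comp (valc E e) (kc _)).
- (* the control function is itself convex: this is the case of the zero
     functional *)
  have := @crossing_control_convex _ _ g p q u v pq ug vg tau tauP u_cvx v_cvx 0 `|g|.
  rewrite normr0 => /(_ (normr_ge0 _)) /convex_functionTP c0.
  apply/convex_functionTP => t x y; rewrite valE.
  by have := c0 t (val x) (val y); rewrite !mul0r !add0r.
- move=> w w_cont w1; pose gS := Subspace (gF 1).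
  have wpsi e : w (psi e) = w gS * tau (val e).
    have -> : psi e = tau (val e) *: gS.
      by apply: val_inj; rewrite /= [RHS]linearZ /= scale1r.
    by rewrite linearZ /= mulrC.
  have gSg : `|gS| = `|g| by rewrite -[g]scale1r.
  have wg : `|w gS| <= `|g|.
    have gS0 : 0 < `|gS| by rewrite gSg normr_gt0.
    have := w1 (`|gS|^-1 *: gS).
    rewrite normrZ normfV normr_id mulVf ?gt_eqF// => /(_ (lexx 1)).
    by rewrite linearZ /= normrM normfV normr_id mulrC ler_pdivrMr// mul1r gSg.
  have := @crossing_control_convex _ _ g p q u v pq ug vg tau tauP u_cvx v_cvx _ _ wg.
  move=> /convex_functionTP cw; apply/convex_functionTP => t x y.
  by rewrite !wpsi valE; exact: cw.
Qed.
End CrossingSet.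

(** * Partial suprema of [phi - f] *)

Definition envelope (R : realType) (V K : Type) (iota : V -> K -> R)
  (c : K -> R) (S : set K) (phi : V) : R := sup [set iota phi x - c x | x in S].

Section Envelope.
Context (R : realType) (V : normedModType R) (K : Type) (iota : V -> K -> R).
Hypothesis iota_lin : forall a phi psi x,
  iota (a *: phi + psi) x = a * iota phi x + iota psi x.
Context (alpha : R).
Hypothesis iota_le : forall phi x, `|iota phi x| <= alpha * `|phi|.
Context (c : K -> R) (m : R) (S : set K).
Hypothesis c_lb : forall x, S x -> m <= c x.
Hypothesis S0 : S !=set0.

Let h := envelope iota c S.

Lemma envelope_ub phi x : S x -> iota phi x - c x <= h phi.
Proof.
move=> Sx; apply: ub_le_sup; last by exists x.
exists (alpha * `|phi| - m) => _ [y Sy <-].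
have := c_lb Sy; have := iota_le phi y; have := ler_norm (iota phi y); lra.
Qed.

Lemma envelope_le phi a : (forall x, S x -> iota phi x - c x <= a) -> h phi <= a.
Proof.
move=> ha; apply: ge_sup; first by case: S0 => x Sx; eexists; exists x.
by move=> _ [x Sx <-]; exact: ha.
Qed.

Let iotaD phi psi x : iota (phi + psi) x = iota phi x + iota psi x.
Proof. by have := iota_lin 1 phi psi x; rewrite scale1r mul1r. Qed.

Let iotaZ a phi x : iota (a *: phi) x = a * iota phi x.
Proof.
have := iota_lin a phi 0 x; have := iotaD 0 0 x; rewrite !addr0; lra.
Qed.

Lemma envelope_convex : convex_function setT h.
Proof.
apply/convex_functionTP => t phi psi; apply: envelope_le => x Sx.
have := envelope_ub phi Sx; have := envelope_ub psi Sx.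
have t0 : 0 <= t%:num by []. 
have t1 : t%:num <= 1 by [].
rewrite iotaD !iotaZ; nra.
Qed.

Lemma envelope_lipschitz phi psi : `|h phi - h psi| <= alpha * `|phi - psi|.
Proof.
have le phi' psi' : h phi' <= h psi' + alpha * `|phi' - psi'|.
  apply: envelope_le => x Sx; have := envelope_ub psi' Sx.
  have := iota_le (phi' - psi') x; have := ler_norm (iota (phi' - psi') x).
  have := iotaD (phi' - psi') psi' x; rewrite subrK; lra.
rewrite ler_norml; have := le phi psi; have := le psi phi.
by rewrite (distrC psi) => h1 h2; apply/andP; split; lra.
Qed.

Lemma envelope_slope_ge g q phi (t : R) :
  (forall x, S x -> q <= iota g x) -> 0 <= t -> h phi + t * q <= h (phi + t *: g).
Proof.
move=> gq t0; rewrite -lerBrDr; apply: envelope_le => x Sx.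
have := envelope_ub (phi + t *: g) Sx; rewrite iotaD iotaZ.
have := gq x Sx; nra.
Qed.

Lemma envelope_slope_le g p phi (t : R) :
  (forall x, S x -> iota g x <= p) -> 0 <= t -> h (phi + t *: g) <= h phi + t * p.
Proof.
move=> gp t0; apply: envelope_le => x Sx.
have := envelope_ub phi Sx; rewrite iotaD iotaZ; have := gp x Sx; nra.
Qed.

End Envelope.

(** * Covering N(f) by tie sets *)

Section Cover.
Context (R : realType) (K : metricType R) (V : normedModType R) (iota : V -> K -> R).
Hypothesis K_compact : compact [set: K].
Hypothesis iota_lin : forall a phi psi x,
  iota (a *: phi + psi) x = a * iota phi x + iota psi x.
Hypothesis iota_cont : forall phi, continuous (iota phi).
Context (alpha : R).
Hypothesis iota_le : forall phi x, `|iota phi x| <= alpha * `|phi|.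
Context (f : K -> \bar R).
Hypothesis f_gtNy : forall x, f x != -oo%E.
Hypothesis f_proper : exists x, (f x < +oo)%E.
Hypothesis f_lsc : lower_semicontinuous f.

Definition dom_above g q := [set x | (f x < +oo)%E /\ q <= iota g x].
Definition dom_below g p := [set x | (f x < +oo)%E /\ iota g x <= p].
Definition tie_set g p q := [set phi |
  envelope iota (fine \o f) (dom_above g q) phi =
  envelope iota (fine \o f) (dom_below g p) phi].

(** The two nonemptiness conditions make both partial suprema genuine; the
    supremum of an empty set of reals is 0 by convention and would carry no
    information on the slope. *)
Definition tie_index := [set i : V * (rat * rat) |
  [/\ i.2.1 < i.2.2, dom_above i.1 (ratr i.2.2) !=set0 &
      dom_below i.1 (ratr i.2.1) !=set0]].

(** A lower semicontinuous function on a compact space attains its infimum, here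
    at a point where [f] is finite; so all partial suprema are finite. *)
Lemma fine_bounded_below : exists m : R, forall x, (f x < +oo)%E -> m <= fine (f x).
Proof.
have [x0 x0E] := compact_minimizer K_compact f_lsc f_proper.
have [x1 x1y] := f_proper.
have fin x : (f x < +oo)%E -> f x = (fine (f x))%:E.
  by move=> fx; rewrite fineK// fin_numE f_gtNy -ltey.
have inf x : (f x0 <= f x)%E by rewrite -x0E; apply: ereal_inf_lbound; exists x.
exists (fine (f x0)) => x fx; rewrite -lee_fin -!fin//.
exact: le_lt_trans (inf x1) x1y.
Qed.

Let iotaD phi psi x : iota (phi + psi) x = iota phi x + iota psi x.
Proof. by have := iota_lin 1 phi psi x; rewrite scale1r mul1r. Qed.

Section TieSet.
Context (g : V) (p q : R).
Hypothesis pq : p < q.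
Hypothesis above : dom_above g q !=set0.
Hypothesis below : dom_below g p !=set0.

Lemma tie_set_dc_hypersurface : dc_hypersurface (tie_set g p q).
Proof.
have [m mP] := fine_bounded_below.
have mA x : dom_above g q x -> m <= (fine \o f) x by case=> /mP.
have mB x : dom_below g p x -> m <= (fine \o f) x by case=> /mP.
(* [iota g] takes a value at most [p] and a value at least [q], not both 0 *)
have [x0 gx0] : exists x, iota g x != 0.
  case: above => x [_ qx]; case: below => y [_ yp].
  have [gx|?] := eqVneq (iota g x) 0; last by exists x.
  have [gy|?] := eqVneq (iota g y) 0; last by exists y.
  by move: qx yp pq; rewrite gx gy; lra.
apply: (@crossing_set_dc_hypersurface _ _ g p q alpha _ _ pq _ _ _ _ _ _
  (fun phi => iota phi x0 / iota g x0)).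
- exact: envelope_lipschitz mA above.
- exact: envelope_lipschitz mB below.
- by move=> phi t; apply: (envelope_slope_ge iota_lin iota_le mA above) => x [].
- by move=> phi t; apply: (envelope_slope_le iota_lin iota_le mB below) => x [].
- exact: envelope_convex mA above.
- exact: envelope_convex mB below.
- by move=> a phi psi; rewrite iota_lin; field.
- apply: (@norm_lipschitz_continuous _ _ R^o (alpha / `|iota g x0|)) => phi psi.
  rewrite -mulrBl normrM normfV mulrAC ler_wpM2r ?invr_ge0//.
  have := iotaD (phi - psi) psi x0; rewrite subrK => ->.
  by rewrite addrK; exact: iota_le.
- by rewrite divff.
Qed.

(** An interior point of the closed tie set would have a whole segment in the
    direction [g] inside it, against the uniqueness of the crossing. *)
Lemma tie_set_nowhere_dense : nowhere_dense (tie_set g p q).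
Proof.
have [m mP] := fine_bounded_below.
have mA x : dom_above g q x -> m <= (fine \o f) x by case=> /mP.
have mB x : dom_below g p x -> m <= (fine \o f) x by case=> /mP.
have cA := norm_lipschitz_continuous (envelope_lipschitz iota_lin iota_le mA above).
have cB := norm_lipschitz_continuous (envelope_lipschitz iota_lin iota_le mB below).
have clT : closed (tie_set g p q).
  have -> : tie_set g p q = [set phi |
      envelope iota (fine \o f) (dom_above g q) phi -
      envelope iota (fine \o f) (dom_below g p) phi = 0].
    apply/seteqP; split=> phi; first by rewrite /tie_set/= => ->; rewrite subrr.
    by move=> /= /eqP; rewrite subr_eq0 => /eqP.
  apply: (@closed_zero_set _ _ R^o) => phi.
  by apply: cvgB; [exact: cA|exact: cB].
rewrite /nowhere_dense -(closure_id _).1//; apply/seteqP; split=> // phi phiT.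
have line : {for 0, continuous (fun t : R => phi + t *: g)}.
  by apply: cvgD; [exact: cvg_cst|apply: cvgZr_tmp; exact: cvg_id].
have near0 : \forall t \near (0 : R), tie_set g p q (phi + t *: g).
  by apply: line; rewrite scale0r addr0.
have [t [/= tT t0]] : exists t : R, tie_set g p q (phi + t *: g) /\ t != 0.
  apply: (@filter_ex _ (0 : R)^'); near=> t; split; near: t.
    exact: nbhs_dnbhs.
  exact: nbhs_dnbhs_neq.
have phiT0 : tie_set g p q (phi + 0 *: g).
  by rewrite scale0r addr0; exact: interior_subset phiT.
move/eqP: t0; apply.
apply: (crossing_unique pq _ _ tT phiT0) => psi s s0.
  by apply: (envelope_slope_ge iota_lin iota_le mA above) => // x [].
by apply: (envelope_slope_le iota_lin iota_le mB below) => // x [].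
Unshelve. all: by end_near. Qed.

End TieSet.

(** Minimizers of [f - phi] are expressed as maximizers of the real-valued
    [iota phi - fine f] on the domain of [f], the form in which the partial
    suprema see them. *)
Lemma not_strong_two_minimizers phi : no_strong_minimum iota f phi ->
  exists x y, [/\ x <> y, (f x < +oo)%E, (f y < +oo)%E,
    forall z, (f z < +oo)%E -> iota phi z - fine (f z) <= iota phi x - fine (f x) &
    forall z, (f z < +oo)%E -> iota phi z - fine (f z) <= iota phi y - fine (f y)].
Proof.
move=> nphi; pose h x := (f x - (iota phi x)%:E)%E.
have h_lsc : lower_semicontinuous h by exact: lsc_sub_continuous.
have fin x : (f x < +oo)%E -> h x = (fine (f x) - iota phi x)%:E.
  by move=> fx; rewrite /h EFinB fineK// fin_numE f_gtNy -ltey.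
have h_proper : exists x, (h x < +oo)%E.
  by have [x fx] := f_proper; exists x; rewrite fin// ltry.
have min_fin x : ereal_inf (range h) = h x -> (f x < +oo)%E.
  move=> hx; have [z hz] := h_proper.
  have : (h x < +oo)%E.
    by rewrite -hx (le_lt_trans _ hz)//; apply: ereal_inf_lbound; exists z.
  by rewrite /h; case: (f x) => [r _|//|_]; [exact: ltry|by rewrite ltNye].
have min_max x z : ereal_inf (range h) = h x -> (f z < +oo)%E ->
    iota phi z - fine (f z) <= iota phi x - fine (f x).
  move=> hx fz; have : (h x <= h z)%E.
    by rewrite -hx; apply: ereal_inf_lbound; exists z.
  by rewrite !fin// ?min_fin// lee_fin; lra.
have [x hx] := compact_minimizer K_compact h_lsc h_proper.
have [y [hy yx]] : exists y, ereal_inf (range h) = h y /\ y <> x.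
  apply/not_existsP => ny; apply: nphi; exists x.
  apply: unique_minimizer_strong => // y hy.
  by have := ny y; rewrite not_andP => -[//|/contrapT].
exists x, y; split; [by move/esym|exact: min_fin|exact: min_fin|..] => z fz;
  exact: min_max.
Qed.

(** Both partial suprema are attained at global maximizers of [phi - f], one on
    each side of the gap between [p] and [q], hence have the same value. *)
Lemma no_strong_minimum_tie (D : set V) : separates_points (iota @` D) ->
  no_strong_minimum iota f `<=` \bigcup_(i in (D `*` setT) `&` tie_index)
     tie_set i.1 (ratr i.2.1) (ratr i.2.2).
Proof.
move=> Dsep phi /not_strong_two_minimizers[x [y [xy fx fy xmax ymax]]].
have [m mP] := fine_bounded_below.
wlog [g Dg gxy] : x y xy fx fy xmax ymax / exists2 g, D g & iota g x < iota g y.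
  have [_ [[g Dg <-] /eqP]] := Dsep _ _ xy.
  rewrite neq_lt => /orP[gxy|gyx] wlg.
    by apply: (wlg x y) => //; exists g.
  by apply: (wlg y x) => //; [exact/nesym|exists g].
have [p] := rat_in_itvoo gxy; rewrite in_itv/= => /andP[xp py].
have [q] := rat_in_itvoo py; rewrite in_itv/= => /andP[pq qy].
have above : dom_above g (ratr q) y by split=> //; exact: ltW.
have below : dom_below g (ratr p) x by split=> //; exact: ltW.
exists (g, (p, q)) => /=.
  by split=> //; split=> /=; [rewrite -(ltr_rat R)|exists y|exists x].
have envE S z : S z -> (forall z', S z' -> (f z' < +oo)%E) ->
    (forall z', (f z' < +oo)%E -> iota phi z' - fine (f z') <= iota phi z - fine (f z)) ->
    envelope iota (fine \o f) S phi = iota phi z - fine (f z).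
  move=> Sz Sf zmax; apply/eqP; rewrite eq_le; apply/andP; split.
    by apply: envelope_le => [|z' /Sf /zmax//]; exists z.
  by apply: (@envelope_ub _ _ _ _ _ iota_le (fine \o f) m) => // z' /Sf /mP.
rewrite /tie_set/= (envE _ y above) ?(envE _ x below)//; try by move=> z [].
by apply/eqP; rewrite eq_le xmax ?ymax.
Qed.

End Cover.

(** * Countable separating families *)

(** Compactness of the square of [K], applied to the filter of large finite
    subfamilies.  Near a pair of distinct points one function separates all
    pairs; near a point of the diagonal there is nothing to separate, as the
    distances are below [e]. *)
Lemma finite_separating (R : realType) (K : metricType R) (V : eqType)
    (iota : V -> K -> R) (e : R) :
  compact [set: K] -> (forall phi, continuous (iota phi)) ->
  separates_points (range iota) -> 0 < e ->
  exists s : seq V, forall x y, e <= mdist x y ->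
    exists2 phi, phi \in s & iota phi x <> iota phi y.
Proof.
move=> cK ic isep e0.
pose F := filter_from [set: seq V] (fun s => [set s' : seq V | {subset s <= s'}]).
have FF : Filter F.
  apply: filter_from_filter; first by exists [::].
  move=> s t _ _; exists (s ++ t) => // r /= str.
  by split=> z zs; apply: str; rewrite mem_cat zs ?orbT.
have cKK : compact [set: K * K] by rewrite -setXTT; exact: compact_setX.
have := (compact_near_coveringP _).1 cKK _ F (fun s (z : K * K) =>
  e <= mdist z.1 z.2 -> exists2 phi, phi \in s & iota phi z.1 <> iota phi z.2) FF.
case=> [[x y] _|s _ sP]; last first.
  by exists s => x y; exact: (sP s _ (x, y)).
have [->|/eqP xy] := eqVneq x y.
  exists (ball y (e / 2) `*` ball y (e / 2), setT).
    split; last exact: filterT.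
    by exists (ball y (e / 2), ball y (e / 2)) => //; split; apply: nbhsx_ballx; rewrite divr_gt0.
  move=> [[x' y'] s] [[/= yx yy] _].
  rewrite leNgt => /negP[]; move: yx yy; rewrite !ballEmdist/=.
  by have := metric_triangle x' y y'; rewrite (metric_sym x' y); lra.
have [_ [[phi _ <-] /eqP phixy]] := isep _ _ xy.
exists ([set z | iota phi z.1 - iota phi z.2 != 0], [set s : seq V | phi \in s]).
  split=> /=.
    apply: open_nbhs_nbhs; split; last by rewrite /= subr_eq0.
    rewrite (_ : mkset _ = ~` [set z | iota phi z.1 - iota phi z.2 = 0]); last first.
      by apply/seteqP; split=> z /= /eqP.
    apply: closed_openC; apply: (@closed_zero_set _ _ R^o) => z.
    apply: cvgB.
      by apply: (continuous_comp (f := fst)); [exact: cvg_fst|exact: ic].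
    by apply: (continuous_comp (f := snd)); [exact: cvg_snd|exact: ic].
  by exists [:: phi] => // s; apply; rewrite inE.
by move=> [z s] [/= zne phis] _; exists phi => //; apply/eqP; rewrite -subr_eq0.
Qed.

Lemma countable_separating (R : realType) (K : metricType R) (V : choiceType)
    (iota : V -> K -> R) :
  compact [set: K] -> (forall phi, continuous (iota phi)) ->
  separates_points (range iota) ->
  exists2 D : set V, countable D & separates_points (iota @` D).
Proof.
move=> cK ic isep.
have /choice[s sP] : forall n : nat, exists s : seq V, forall x y,
    n.+1%:R^-1 <= mdist x y -> exists2 phi, phi \in s & iota phi x <> iota phi y.
  by move=> n; apply: finite_separating.
exists (\bigcup_n [set` s n]).
  apply: bigcup_countable => // n _.
  by apply: finite_set_countable; exact: finite_seq.
move=> x y /eqP xy; have d0 : 0 < mdist x y by rewrite mdist_gt0.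
have [n nxy] : exists n : nat, n.+1%:R^-1 <= mdist x y.
  by exists (Num.truncn (mdist x y)^-1); rewrite invf_ple ?posrE// ltW// truncnS_gt.
have [phi phis ne] := sP n x y nxy.
by exists (iota phi); split=> //; exists phi => //; exists n.
Qed.

Lemma dense_separating (R : realType) (K : metricType R) (V : normedModType R)
    (iota : V -> K -> R) (D : set V) :
  (forall x, continuous (iota^~ x)) ->
  separates_points (range iota) -> dense D -> separates_points (iota @` D).
Proof.
move=> ic isep dD x y xy; have [_ [[phi _ <-] ne]] := isep x y xy.
have [||psi [psine Dpsi]] := dD [set psi | iota psi x - iota psi y != 0].
- by exists phi; rewrite /= subr_eq0; exact/eqP.
- have -> : [set psi | iota psi x - iota psi y != 0] =
      ~` [set psi | iota psi x - iota psi y = 0].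
    by apply/seteqP; split=> psi /= /eqP.
  apply: closed_openC; apply: (@closed_zero_set _ _ R^o) => psi.
  by apply: cvgB; exact: ic.
exists (iota psi); split; first by exists psi.
by apply/eqP; rewrite -subr_eq0.
Qed.

(** * The set N(f) for a normed space of continuous functions *)

Section NoStrongMinimum.
Context (R : realType) (K : metricType R) (V : normedModType R) (iota : V -> K -> R).
Hypothesis K_compact : compact [set: K].
Hypothesis iota_lin : forall a phi psi x,
  iota (a *: phi + psi) x = a * iota phi x + iota psi x.
Hypothesis iota_cont : forall phi, continuous (iota phi).
Context (alpha : R).
Hypothesis iota_le : forall phi x, `|iota phi x| <= alpha * `|phi|.
Hypothesis iota_sep : separates_points (range iota).
Context (f : K -> \bar R).
Hypothesis f_gtNy : forall x, f x != -oo%E.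
Hypothesis f_proper : exists x, (f x < +oo)%E.
Hypothesis f_lsc : lower_semicontinuous f.

Theorem no_strong_minimum_first_category : first_category (no_strong_minimum iota f).
Proof.
have [D Dcount Dsep] := countable_separating K_compact iota_cont iota_sep.
pose I := (D `*` setT) `&` tie_index iota f.
have Icount : countable I.
  by apply: sub_countable (countableX Dcount (countableP [set: rat * rat]));
    apply: subset_card_le; exact: subIsetl.
have [code codeI] := countable_injP _ Icount.
(* an injective code of the countable index set turns the family of tie sets into
   a sequence, padded with empty sets *)
pose B n := no_strong_minimum iota f `&`
  \bigcup_(i in I `&` [set i | code i = n]) tie_set iota f i.1 (ratr i.2.1) (ratr i.2.2).
exists B; split=> [n|].
  have [[i [Ii in_]]|noi] := pselect (exists i, I i /\ code i = n).
    have Bi : B n `<=` tie_set iota f i.1 (ratr i.2.1) (ratr i.2.2).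
      move=> phi [_ [j [Ij jn]]]; rewrite (codeI i j) ?inE//.
      by rewrite in_ jn.
    have [_ [pq above below]] := Ii.
    have nd : nowhere_dense (tie_set iota f i.1 (ratr i.2.1) (ratr i.2.2)).
      by apply: (@tie_set_nowhere_dense _ _ _ _ _ _ alpha) => //; rewrite ltr_rat.
    apply/seteqP; split=> // phi; rewrite -nd.
    by apply: interiorS; exact: closureS.
  rewrite /nowhere_dense (_ : B n = set0) ?closure0 ?interior0//.
  apply/seteqP; split=> // phi [_ [i [Ii in_]]].
  by case: noi; exists i.
apply/seteqP; split=> [phi nphi|phi [n _ []]//].
have [i Ii ti] := no_strong_minimum_tie K_compact iota_cont iota_le f_gtNy
   f_proper f_lsc Dsep nphi.
by exists (code i) => //; split=> //; exists i.
Qed.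

Theorem no_strong_minimum_dc_covered : separable V ->
  countably_dc_covered (no_strong_minimum iota f).
Proof.
move=> [D [Dcount Ddense]].
have iota_contl x : continuous (iota^~ x).
  apply: (@norm_lipschitz_continuous _ _ R^o alpha) => phi psi.
  have := iota_lin 1 (phi - psi) psi x; rewrite scale1r mul1r subrK => ->.
  by rewrite addrK; exact: iota_le.
have Dsep := dense_separating iota_contl iota_sep Ddense.
pose I := (D `*` setT) `&` tie_index iota f.
have Icount : countable I.
  by apply: sub_countable (countableX Dcount (countableP [set: rat * rat]));
    apply: subset_card_le; exact: subIsetl.
exists ((fun i => tie_set iota f i.1 (ratr i.2.1) (ratr i.2.2)) @` I); split.
- exact: sub_countable (card_image_le _ _) Icount.
- move=> _ [i [_ [pq above below]] <-].
  by apply: (@tie_set_dc_hypersurface _ _ _ _ _ _ alpha) => //; rewrite ltr_rat.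
- move=> phi /(no_strong_minimum_tie K_compact iota_cont iota_le f_gtNy
    f_proper f_lsc Dsep)[i Ii ti].
  by exists (tie_set iota f i.1 (ratr i.2.1) (ratr i.2.2)) => //; exists i.
Qed.
End NoStrongMinimum.

Lemma le_sup_norm (R : realType) (K : metricType R) (h : K -> R) (x : K) :
  compact [set: K] -> continuous h -> `|h x| <= sup_norm h.
Proof.
move=> cK hc; apply: ub_le_sup; last by exists x.
have : bounded_set (h @` setT : set R^o).
  by apply: compact_bounded; apply: continuous_compact => //; exact: continuous_subspaceT.
move=> /pinfty_ex_gt0[M _ hM]; exists M => _ [y _ <-].
by apply: hM; exists y.
Qed.

Theorem lemma3 (R : realType) (K : metricType R)
    (K_compact : compact [set: K])
    (Y : completeNormedModType R) (iota : {linear Y -> (K -> R^o)})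
    (iota_inj : injective iota)
    (iota_cont : forall phi, continuous (iota phi))
    (Y_sep : separates_points (range iota))
    (alpha : R) (alpha_ge0 : 0 <= alpha)
    (sup_norm_le : forall phi, sup_norm (iota phi) <= alpha * `|phi|)
    (f : K -> \bar R) (f_gtNy : forall x, f x != -oo%E)
    (f_proper : exists x, (f x < +oo)%E)
    (f_lsc : lower_semicontinuous f) :
  [/\ first_category (no_strong_minimum iota f),
      forall Z : submodClosed Y,
        closed [set` Z] -> separable (subspace_of Z) ->
        separates_points (iota @` [set` Z]) ->
        countably_dc_covered
          [set z : subspace_of Z | no_strong_minimum iota f (val z)] &
      separable Y -> countably_dc_covered (no_strong_minimum iota f)].
Proof.
have iota_lin a phi psi x : iota (a *: phi + psi) x = a * iota phi x + iota psi x.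
  by rewrite linearP.
have iota_le phi x : `|iota phi x| <= alpha * `|phi|.
  exact: le_trans (le_sup_norm x K_compact (iota_cont phi)) (sup_norm_le phi).
split.
- exact: (@no_strong_minimum_first_category R K Y iota K_compact iota_lin iota_cont alpha
    iota_le Y_sep f).
- move=> Z _ Zsep Zpts.
  apply: (@no_strong_minimum_dc_covered R K (subspace_of Z) (fun z => iota (val z))
    K_compact _ _ alpha) => //.
  + move=> a phi psi x; rewrite -iota_lin.
    have -> : val (a *: phi + psi) = a *: val phi + val psi; last by [].
    by rewrite raddfD; congr (_ + _); exact: linearZ.
  + move=> x y /Zpts[_ [[z zZ <-] ne]]; exists (iota z); split=> //.
    by exists (Subspace zZ).
- exact: (@no_strong_minimum_dc_covered R K Y iota K_compact iota_lin iota_cont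
    alpha iota_le Y_sep f).
Qed.
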